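(* Let $C$ be the unit circle $x^2+y^2=1$. There are infinitely many rational numbers $r$ such that for each such $r$ there is an $r$-geometric progression sequence of rational points of length at least $3$ on $C$.
   Context: $C(\mathbb{Q})=\{(x,y)\in\mathbb{Q}^2 : x^2+y^2=1\}$ is the set of rational points on the unit circle $C$. For $r\in\mathbb{Q}$, a sequence of rational points $(x_1,y_1),\ldots,(x_n,y_n)$ in $C(\mathbb{Q})$ is said to form an $r$-geometric progression sequence of length $n$ if $x_i/x_{i-1}=r$ for every $i=2,\ldots,n$ (in particular the denominators $x_{i-1}$ are nonzero). *)

(* Defs.v *)
From mathcomp Require Import all_boot all_order all_algebra.
From mathcomp Require Import classical_sets cardinality.

Set Implicit Arguments.
Unset Strict Implicit.
Unset Printing Implicit Defensive.

Import GRing.Theory.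

Local Open Scope classical_set_scope.
Local Open Scope ring_scope.

Definition unit_circle : set (rat * rat) :=
  [set P | P.1 ^+ 2 + P.2 ^+ 2 = 1].

(* Only x-coordinates form the progression. Since x / 0 = 0 in rat,
   nonvanishing of the denominators is required explicitly; the last
   x-coordinate is not a denominator and may vanish. *)
Definition geometric_progression (r : rat) (s : seq (rat * rat)) : Prop :=
  (forall P, P \in s -> unit_circle P) /\
  (forall i, (i.+1 < size s)%N ->
     (nth (0, 0) s i).1 != 0 /\
     (nth (0, 0) s i.+1).1 / (nth (0, 0) s i).1 = r).

(* Main.v *)
(** Fix the middle abscissa 3/5, so q = 9/25 is the product of the two outer
    ones. A first abscissa x works iff 1 - x^2 and x^2 - q^2 are both squares;
    with k^2 = 1 - q^2 this genus one curve is x = dn u, y = k sn u, z = k cn u,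
    and it contains (117, 44, 108) / 125. It is translated by the points
    (sn v, cn v, dn v) of the Jacobi curve. Doubling v repeatedly raises the
    2-adic valuation of sn v by exactly one each time, so the differences
    dn (u - v) - dn (u + v) = 2 y z (sn v) (cn v) / (1 - y^2 (sn v)^2) are
    pairwise distinct, which is impossible with finitely many abscissas. *)

Require Import Defs.
From mathcomp Require Import all_boot all_order all_algebra.
From mathcomp Require Import classical_sets cardinality.
From mathcomp Require Import boolp ring lra zify.

Import Order.TTheory GRing.Theory Num.Theory.

Local Open Scope classical_set_scope.
Local Open Scope ring_scope.

(** * Integers and units at the prime 2 *)

Definition int2 (x : rat) : Prop :=
  exists a b : int, x = a%:~R / (2 * b%:~R + 1).

(** The residue field at 2 has two elements, so these are exactly the units of the local ring
    [int2]. Valuation n is expressed below as [2 ^+ n] times such a unit. *)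
Definition unit2 (x : rat) : Prop := exists2 w, int2 w & x = 1 + 2 * w.

Lemma odd_rat_neq0 (b : int) : 2 * b%:~R + 1 != 0 :> rat.
Proof.
have -> : 2 * b%:~R + 1 = (2 * b + 1)%:~R :> rat by rewrite intrD intrM.
rewrite intr_eq0; lia.
Qed.

Lemma int2D x y : int2 x -> int2 y -> int2 (x + y).
Proof.
move=> [a [b ->]] [c [d ->]].
(* The common denominator is (2b + 1)(2d + 1) = 2(2bd + b + d) + 1. *)
exists (a * (2 * d + 1) + c * (2 * b + 1)), (2 * b * d + b + d).
have := odd_rat_neq0 (2 * b * d + b + d).
have := odd_rat_neq0 b; have := odd_rat_neq0 d.
rewrite !(intrD, intrM) => d0 b0 bd0; field.
by rewrite d0 b0 bd0.
Qed.

Lemma int2M x y : int2 x -> int2 y -> int2 (x * y).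
Proof.
move=> [a [b ->]] [c [d ->]].
exists (a * c), (2 * b * d + b + d).
have := odd_rat_neq0 (2 * b * d + b + d).
have := odd_rat_neq0 b; have := odd_rat_neq0 d.
rewrite !(intrD, intrM) => d0 b0 bd0; field.
by rewrite d0 b0 bd0.
Qed.

Lemma int2_int (m : int) : int2 m%:~R.
Proof. by exists m, 0; rewrite mulr0 add0r divr1. Qed.

Lemma int2N x : int2 x -> int2 (- x).
Proof. by rewrite -mulN1r; apply: int2M; exact: (int2_int (-1)). Qed.

Lemma half_not_int2 : ~ int2 2^-1.
Proof.
move=> [a [b /(congr1 ( *%R (2 * (2 * b%:~R + 1))))]].
have b0 := odd_rat_neq0 b.
have -> : 2 * (2 * b%:~R + 1) / 2 = (2 * b + 1)%:~R :> rat.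
  by rewrite intrD intrM; field.
have -> : 2 * (2 * b%:~R + 1) * (a%:~R / (2 * b%:~R + 1)) = (2 * a)%:~R :> rat.
  by rewrite intrM; field.
move=> /intr_inj; lia.
Qed.

Lemma unit2_int2 u : unit2 u -> int2 u.
Proof.
move=> [w w2 ->]; apply: int2D; first exact: (int2_int 1).
by apply: int2M => //; exact: (int2_int 2).
Qed.

Lemma unit2_neq0 u : unit2 u -> u != 0.
Proof.
move=> [w w2 ->]; apply/eqP => u0; apply: half_not_int2.
have -> : 2^-1 = - w by lra.
exact: int2N.
Qed.

Lemma unit2M u v : unit2 u -> unit2 v -> unit2 (u * v).
Proof.
move=> uu [w w2 ->]; have [t t2 uE] := uu.
exists (t + u * w); last by rewrite uE; ring.
by apply: int2D => //; apply: int2M => //; exact: unit2_int2.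
Qed.

(** A unit is a quotient of two odd integers, and so is its inverse. *)
Lemma unit2V u : unit2 u -> unit2 u^-1.
Proof.
move=> uu; have u0 := unit2_neq0 _ uu.
have [_ [a [b ->]] uE] := uu; have b0 := odd_rat_neq0 b.
have ab0 := odd_rat_neq0 (a + b).
have u_frac : u = (2 * (a + b)%:~R + 1) / (2 * b%:~R + 1).
  by rewrite uE intrD; field.
exists ((- a)%:~R / (2 * (a + b)%:~R + 1)); first by exists (- a), (a + b).
rewrite u_frac; move: ab0; rewrite intrN intrD => ab0; field.
by rewrite b0 ab0.
Qed.

Lemma unit2D2 u w : unit2 u -> int2 w -> unit2 (u + 2 * w).
Proof.
move=> [t t2 ->] w2; exists (t + w); first exact: int2D.
by ring.
Qed.

Lemma int2_nat (m : nat) : int2 m%:R.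
Proof. exact: (int2_int m). Qed.

Lemma unit2_nat (m : nat) : odd m -> unit2 m%:R.
Proof.
move=> om; exists (m./2)%:R; first exact: int2_nat.
by rewrite -{1}(odd_double_half m) om natrD -mul2n natrM.
Qed.

Lemma int2_exp2_unit2 n t : unit2 t -> int2 (2 ^+ n * t).
Proof.
move=> ut; apply: int2M; last exact: unit2_int2.
by have := int2_int (2 ^+ n); rewrite rmorphXn.
Qed.

(** After cancelling [2 ^+ m], an equality divided by 2u would put 1/2 in the local ring. *)
Lemma exp2_unit2_lt (m n : nat) u v :
  (m < n)%N -> unit2 u -> unit2 v -> 2 ^+ m * u != 2 ^+ n * v.
Proof.
move=> mn uu uv; apply/eqP => e; apply: half_not_int2.
have u0 := unit2_neq0 _ uu.
have e2 : u = 2 * (2 ^+ (n - m.+1) * v).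
  apply: (mulfI (expf_neq0 m (_ : 2 != 0 :> rat))) => //.
  by rewrite e -{1}(subnKC mn) exprD exprS; ring.
have -> : 2^-1 = 2 ^+ (n - m.+1) * v * u^-1.
  have -> : 2 ^+ (n - m.+1) * v = u / 2 by rewrite e2; field.
  by field.
apply: int2M; first exact: int2_exp2_unit2.
exact/unit2_int2/unit2V.
Qed.

Lemma exp2_unit2_inj (m n : nat) u v :
  unit2 u -> unit2 v -> 2 ^+ m * u = 2 ^+ n * v -> m = n.
Proof.
move=> uu uv e; case: (ltngtP m n) => // mn.
  by have := exp2_unit2_lt _ _ _ _ mn uu uv; rewrite e eqxx.
by have := exp2_unit2_lt _ _ _ _ mn uv uu; rewrite e eqxx.
Qed.

(** * Points of growing 2-adic valuation on the Jacobi curve *)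

(** Here (s, c, d) = (sn, cn, dn) with squared modulus [k2]. The offset 3 comes from the base point,
    where [s] is 8 times a unit. *)
Definition jacobi_point (k2 : rat) (n : nat) (s c d : rat) : Prop :=
  [/\ s ^+ 2 + c ^+ 2 = 1, d ^+ 2 + k2 * s ^+ 2 = 1,
      exists2 t, unit2 t & s = 2 ^+ n.+3 * t, unit2 c & unit2 d].

(** Duplication formulas, with sn 2v = 2 s c d / (1 - k^2 s^4): as [c], [d] and the denominator are
    units, only the factor 2 changes the valuation. *)
Lemma jacobi_point_double kh n s c d :
  int2 kh -> jacobi_point (2 * kh) n s c d ->
  exists s' c' d', jacobi_point (2 * kh) n.+1 s' c' d'.
Proof.
move=> kh2 [sc ds [t ut sE] uc ud].
have s_half : s = 2 * (2 ^+ n.+2 * t) by rewrite sE exprS; ring.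
have h2 := int2_exp2_unit2 n.+2 _ ut.
move: (2 ^+ n.+2 * t) s_half h2 => h s_half h2.
have s2 : int2 s by rewrite s_half; apply: int2M => //; exact: (int2_int 2).
have [c2 d2] := (unit2_int2 _ uc, unit2_int2 _ ud).
have unit2_sub u w : unit2 u -> int2 w -> unit2 (u - 2 * w).
  by move=> uu /int2N w2; rewrite -mulrN; exact: unit2D2.
pose D := 1 - (2 * kh) * s ^+ 4.
have uD : unit2 D.
  have -> : D = 1%:R - 2 * (kh * (s * s * (s * s))).
    by rewrite /D; ring.
  by apply: unit2_sub; [exact: (unit2_nat 1) | do ?apply: int2M].
have D0 := unit2_neq0 _ uD; have uV := unit2V _ uD.
have csE : c ^+ 2 = 1 - s ^+ 2 by lra.
have dsE : d ^+ 2 = 1 - (2 * kh) * s ^+ 2 by lra.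
exists (2 * s * c * d / D), ((c ^+ 2 - s ^+ 2 * d ^+ 2) / D),
  ((d ^+ 2 - (2 * kh) * s ^+ 2 * c ^+ 2) / D); split.
- rewrite !(expr_div_n, exprMn) csE dsE; move: D0; rewrite /D => D0.
  by field.
- rewrite !(expr_div_n, exprMn) csE dsE; move: D0; rewrite /D => D0.
  by field.
- exists (t * (c * d * D^-1)); first by do !apply: unit2M.
  by rewrite sE [in RHS]exprS; ring.
- apply: unit2M => //.
  have -> : c ^+ 2 - s ^+ 2 * d ^+ 2 = c * c - 2 * (h * s * (d * d)).
    by rewrite [in s ^+ 2]expr2 {1}s_half; ring.
  by apply: unit2_sub; [exact: unit2M | do ?apply: int2M].
- apply: unit2M => //.
  have -> : d ^+ 2 - (2 * kh) * s ^+ 2 * c ^+ 2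
      = d * d - 2 * (kh * (s * s) * (c * c)).
    by ring.
  by apply: unit2_sub; [exact: unit2M | do ?apply: int2M].
Qed.

(* Numerical identities are proved over an abstract field: in [rat] the
   conversion test would compute with the literals in unary. *)
Lemma base_point_on_curve (F : realFieldType) (a b : F) :
  a = 113 + 2 * (63 * 500) -> b = 537 + 2 * (80 * 500) ->
  (8 * (7 * 29 * 37) / a) ^+ 2 + (27 * 5 * 11 * 13 / a) ^+ 2 = 1 /\
  (9 / 25 * (b / a)) ^+ 2 + 2 * (272 / 625) * (8 * (7 * 29 * 37) / a) ^+ 2 = 1.
Proof.
move=> aE bE; have a0 : 113 + 2 * (63 * 500) != 0 :> F by apply: lt0r_neq0; lra.
by split; rewrite aE ?bE; field.
Qed.

Lemma middle_point (F : realFieldType) :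
  [/\ 3 / 5 != 0 :> F, (3 / 5) ^+ 2 + (4 / 5) ^+ 2 = 1 :> F
    & (3 / 5) ^+ 2 = 9 / 25 :> F].
Proof. by split; [apply: lt0r_neq0; lra | field | field]. Qed.

Lemma initial_point (F : realFieldType) :
  [/\ (117 / 125) ^+ 2 + (44 / 125) ^+ 2 = 1 :> F,
      (117 / 125) ^+ 2 - (108 / 125) ^+ 2 = (9 / 25) ^+ 2 :> F
    & 44 / 125 * (108 / 125) = 2 ^+ 4 * (27 * 11 / (125 * 125)) :> F].
Proof. by split; field. Qed.

Lemma modulusE (F : realFieldType) :
  2 * (272 / 625) = 1 - (9 / 25) ^+ 2 :> F.
Proof. by field. Qed.

(* The base point is the double of the point u of the header, translated by the
   4-torsion point (1, 0, q). *)
Lemma jacobi_point_exists n : exists s c d,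
  jacobi_point (2 * (272 / 625)) n s c d.
Proof.
have kh2 : int2 (272 / 625).
  by apply: int2M; [exact: (int2_nat 272)|];
    apply/unit2_int2/unit2V/(unit2_nat 625).
elim: n => [|n [s [c [d]]]]; last exact: jacobi_point_double kh2.
(* The values 63113 and 80537 stay opaque; splitting them as odd + 2 * integer proves them units
   with small numerals only. *)
have [a aE] : exists a : rat, a = 113 + 2 * (63 * 500)
  by exact: (ex_intro _ _ erefl).
have [b bE] : exists b : rat, b = 537 + 2 * (80 * 500)
  by exact: (ex_intro _ _ erefl).
have [circ dn] := base_point_on_curve _ _ _ aE bE.
have ua : unit2 a^-1.
  rewrite aE; apply/unit2V/unit2D2; first exact: (unit2_nat 113).
  by apply: int2M; [exact: (int2_nat 63) | exact: (int2_nat 500)].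
have ub : unit2 b.
  rewrite bE; apply: unit2D2; first exact: (unit2_nat 537).
  by apply: int2M; [exact: (int2_nat 80) | exact: (int2_nat 500)].
exists (8 * (7 * 29 * 37) / a), (27 * 5 * 11 * 13 / a), (9 / 25 * (b / a)).
split; [exact: circ | exact: dn | | |].
- exists (7 * 29 * 37 * a^-1); last by ring.
  apply: unit2M; [apply: unit2M; [apply: unit2M|]|exact: ua].
  + exact: (unit2_nat 7).
  + exact: (unit2_nat 29).
  + exact: (unit2_nat 37).
- apply: unit2M; [apply: unit2M; [apply: unit2M; [apply: unit2M|]|]|exact: ua].
  + exact: (unit2_nat 27).
  + exact: (unit2_nat 5).
  + exact: (unit2_nat 11).
  + exact: (unit2_nat 13).
- apply: unit2M; apply: unit2M; [| apply: unit2V | exact: ub | exact: ua].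
  + exact: (unit2_nat 9).
  + exact: (unit2_nat 25).
Qed.

(* The addition theorems of dn, k sn and k cn, at (x, y, z) = (dn, k sn, k cn) u
   and (s, c, d) = (sn, cn, dn) v, where k^2 = 1 - q^2. *)
Lemma dn_addition (q x y z s c d : rat) (D := 1 - y ^+ 2 * s ^+ 2) :
  x ^+ 2 + y ^+ 2 = 1 -> x ^+ 2 - z ^+ 2 = q ^+ 2 ->
  s ^+ 2 + c ^+ 2 = 1 -> d ^+ 2 + (1 - q ^+ 2) * s ^+ 2 = 1 -> D != 0 ->
  ((x * d - y * z * s * c) / D) ^+ 2 + ((y * c * d + z * x * s) / D) ^+ 2 = 1 /\
  ((x * d - y * z * s * c) / D) ^+ 2 - ((z * c - y * x * s * d) / D) ^+ 2
    = q ^+ 2.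
Proof.
move=> xy xz sc ds D0.
have xE : x ^+ 2 = 1 - y ^+ 2 by lra.
have zE : z ^+ 2 = 1 - y ^+ 2 - q ^+ 2 by lra.
have cE : c ^+ 2 = 1 - s ^+ 2 by lra.
have dE : d ^+ 2 = 1 - (1 - q ^+ 2) * s ^+ 2 by lra.
have D2 := expf_neq0 2 D0.
(* Over the denominator [D ^+ 2] the cross terms 2xyzscd cancel, which leaves an identity in [y],
   [s] and [q]. *)
split; rewrite !expr_div_n -?mulrDl -?mulrBl; apply: (mulIf D2);
  rewrite (divfK D2) !(sqrrB, sqrrD, exprMn) xE zE cE dE /D; ring.
Qed.

(** * Ratios of three-term progressions *)

Definition gp_ratios : set rat := [set r : rat |
  exists s : seq (rat * rat), (3 <= size s)%N /\ geometric_progression r s].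

Lemma gp_ratio_of_squares (m n x y z : rat) :
  m != 0 -> m ^+ 2 + n ^+ 2 = 1 ->
  x ^+ 2 + y ^+ 2 = 1 -> x ^+ 2 - z ^+ 2 = (m ^+ 2) ^+ 2 ->
  gp_ratios (m / x).
Proof.
move=> m0 mn xy xz.
(* Indeed x^2 = z^2 + m^4 with [m] nonzero. *)
have x0 : x != 0.
  apply/eqP => x0; have := sqr_ge0 z; have : 0 < (m ^+ 2) ^+ 2.
    by rewrite exprn_even_gt0 // expf_neq0.
  by rewrite -xz x0; lra.
(* The third point is on the circle because m^4 + z^2 = x^2. *)
exists [:: (x, y); (m, n); (m ^+ 2 / x, z / x)]; split=> //; split.
  move=> P; rewrite !inE => /or3P [] /eqP -> /=; rewrite /unit_circle /= //.
  by rewrite !expr_div_n -mulrDl -xz subrK divff // expf_neq0.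
move=> [|[|i]] //= _; split=> //; field; rewrite ?x0 ?m0 //.
Qed.

Lemma gp_ratio_translate (x y z s c d : rat) :
  x ^+ 2 + y ^+ 2 = 1 -> x ^+ 2 - z ^+ 2 = (9 / 25) ^+ 2 ->
  s ^+ 2 + c ^+ 2 = 1 -> d ^+ 2 + (1 - (9 / 25) ^+ 2) * s ^+ 2 = 1 ->
  1 - y ^+ 2 * s ^+ 2 != 0 ->
  gp_ratios (3 / 5 / ((x * d - y * z * s * c) / (1 - y ^+ 2 * s ^+ 2))).
Proof.
move=> xy xz sc ds D0.
have [P Q] := dn_addition _ _ _ _ _ _ _ xy xz sc ds D0.
have [m0 mn m2] := middle_point rat; rewrite -m2 in Q.
exact: gp_ratio_of_squares m0 mn P Q.
Qed.

(** Translating by (s, c, d) and (-s, c, d) gives two abscissas over the same denominator, a unit.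
    Their difference 2 y z s c / D has valuation 1 + 4 + (n + 3) = n + 8. *)
Lemma gp_ratio_difference (x y z v : rat) (n : nat) :
  x ^+ 2 + y ^+ 2 = 1 -> x ^+ 2 - z ^+ 2 = (9 / 25) ^+ 2 ->
  int2 y -> unit2 v -> y * z = 2 ^+ 4 * v ->
  exists r r' u, [/\ gp_ratios r, gp_ratios r', unit2 u
    & 3 / 5 / r' - 3 / 5 / r = 2 ^+ (n + 8) * u].
Proof.
move=> xy xz y2 uv yz.
have [s [c [d [sc ds [t ut sE] uc ud]]]] := jacobi_point_exists n.
rewrite (modulusE rat) in ds.
pose D := 1 - y ^+ 2 * s ^+ 2.
have uD : unit2 D.
  have h2 := int2_exp2_unit2 n.+2 _ ut.
  have s2 : int2 s by rewrite sE; exact: int2_exp2_unit2.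
  have -> : D = 1%:R + 2 * (- (y * y * (2 ^+ n.+2 * t * s))).
    by rewrite /D [s ^+ 2]expr2 {1}sE [2 ^+ n.+3]exprS; ring.
  apply: unit2D2; first exact: (unit2_nat 1).
  apply: int2N; apply: int2M; first exact: int2M.
  exact: int2M.
have D0 := unit2_neq0 _ uD; have uV := unit2V _ uD.
have Rr := gp_ratio_translate _ _ _ _ _ _ xy xz sc ds D0.
have := gp_ratio_translate x y z (- s) c d xy xz.
rewrite sqrrN => /(_ sc ds D0) Rr'.
do 2 eexists; exists (v * (t * (c * D^-1))).
split; [exact: Rr | exact: Rr' | by do !apply: unit2M |].
(* This recovers the first abscissa from the ratio. *)
have divKl (w : rat) : 3 / 5 / (3 / 5 / w) = w.
  by have [m0 _ _] := middle_point rat; rewrite invf_div mulrCA divff ?mulr1.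
rewrite !divKl -/D -mulrBl.
have -> : x * d - y * z * - s * c - (x * d - y * z * s * c)
    = 2 * (y * z) * s * c.
  by ring.
by rewrite yz sE exprD !exprS; ring.
Qed.

Theorem theorem3p1 :
  infinite_set [set r : rat |
    exists s : seq (rat * rat), (3 <= size s)%N /\ geometric_progression r s].
Proof.
move=> fin; have [xy xz yz] := initial_point rat.
have y2 : int2 (44 / 125).
  by apply: int2M; [exact: (int2_nat 44)|];
    apply/unit2_int2/unit2V/(unit2_nat 125).
have uv : unit2 (27 * 11 / (125 * 125)).
  apply: unit2M; [apply: unit2M | apply: unit2V; apply: unit2M].
  - exact: (unit2_nat 27).
  - exact: (unit2_nat 11).
  - exact: (unit2_nat 125).
  - exact: (unit2_nat 125).
(* The sequence [e] picks for each n a difference of abscissas of valuation n + 8, hence is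
   injective. *)
have /choice [e eP] : forall n, exists v r r' u,
    [/\ gp_ratios r, gp_ratios r', unit2 u
      & v = 3 / 5 / r' - 3 / 5 / r /\ v = 2 ^+ (n + 8) * u].
  move=> n; have [r [r' [u [Rr Rr' uu E]]]] :=
    gp_ratio_difference _ _ _ _ n xy xz y2 uv yz.
  exists (3 / 5 / r' - 3 / 5 / r), r, r', u.
  by split; [exact: Rr | exact: Rr' | exact: uu | split].
have e_inj : injective e.
  move=> m n; have [_ [_ [u [_ _ uu [_ ->]]]]] := eP m.
  have [_ [_ [w [_ _ uw [_ ->]]]]] := eP n.
  by move=> /(exp2_unit2_inj _ _ _ _ uu uw) /addIn.
(* Finitely many ratios would give finitely many differences, yet [e] embeds the naturals among
   them. *)
have fin2 := finite_image2 (fun r r' : rat => 3 / 5 / r' - 3 / 5 / r) fin fin.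
have e_inj2 (B : set rat) : {in (e @^-1` B)%classic &, injective e}.
  by move=> m n _ _; exact: e_inj.
apply/infinite_nat/(sub_finite_set _ (finite_preimage (e_inj2 _) fin2)) => n _.
have [r [r' [u [Rr Rr' _ [eE _]]]]] := eP n.
by exists r; [exact: Rr | exists r'; [exact: Rr' | exact: esym eE]].
Qed.
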